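(* Let $\nu\in\mathcal P_s$ with $\nu(\{0\})=0$, and let $t\ge a>0$ with $\nu(\{a\})=\nu(\{t\})=0$ and $G(t)\neq2G(a)$. Then $$I(1,a,t)=\tfrac12G(t)+\tfrac12H(a)\Psi\big(\tfrac at\big)+\tfrac12G(a),$$ and for all $n\ge2$ $$I(n,a,t)=C_1\Big(\frac{G(t)}2\Big)^{n-1}+G(a)^n\big[C_2n+C_3\big],$$ where $$C_1=I(1,a,t)-\frac{G(a)}{2G(a)-G(t)}\Big[G(a)+H(a)\Psi\big(\tfrac at\big)\Big(1-\frac{G(t)}{2G(a)-G(t)}\Big)\Big],\qquad C_2=\frac{H(a)\Psi(\frac at)}{2G(a)-G(t)},$$ $$C_3=\frac{H(a)\Psi(\frac at)+G(a)}{2G(a)-G(t)}-\frac{2H(a)G(a)\Psi(\frac at)}{(2G(a)-G(t))^2}.$$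
   Context: Fix $\alpha>0$. $\mathcal P_s$ is the set of symmetric Borel probability measures on $\mathbb R$. For $x\in\mathbb R$, $\widetilde\delta_x=\frac12(\delta_x+\delta_{-x})$. For a probability measure $\lambda=\mathcal L(X)$ and $c>0$, $T_c\lambda=\mathcal L(cX)$, and $T_0\lambda=\delta_0$. $\widetilde\pi_{2\alpha}$ is the symmetric Pareto probability measure with density $\alpha|y|^{-2\alpha-1}\mathbf 1_{\{|y|\ge1\}}$. The Kendall convolution $\vartriangle_\alpha$ on $\mathcal P_s$ is defined by $\widetilde\delta_x\vartriangle_\alpha\widetilde\delta_y=T_M\big(\varrho^\alpha\widetilde\pi_{2\alpha}+(1-\varrho^\alpha)\widetilde\delta_1\big)$ where $M=\max(|x|,|y|)$, $m=\min(|x|,|y|)$, $\varrho=m/M$ (and $\varrho=0$ if $M=0$), extended by $(\nu_1\vartriangle_\alpha\nu_2)(A)=\int\int(\widetilde\delta_x\vartriangle_\alpha\widetilde\delta_y)(A)\,\nu_1(dx)\nu_2(dy)$. For $x\in\mathbb R$ and $\mu\in\mathcal P_s$ we write $\delta_x\vartriangle_\alpha\mu:=\widetilde\delta_x\vartriangle_\alpha\mu$. $\Psi(t)=(1-|t|^\alpha)_+$. For the measure $\nu$: $F(t)=\nu((-\infty,t])$, $G(t)=\int_{\mathbb R}\Psi(x/t)\,\nu(dx)$ for $t\neq0$, and for $t>0$, $H(t)=2F(t)-1-G(t)=t^{-\alpha}\int_{[-t,t]}|x|^\alpha\nu(dx)$. The Kendall random walk with step distribution $\nu$ is the Markov chain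 $(X_n)_{n\ge0}$ with $X_0=0$ and transition kernel $\mathbb P(X_{k+1}\in A\mid X_k=x)=(\delta_x\vartriangle_\alpha\nu)(A)$. For $a,t>0$ and $n\ge1$, $I(n,a,t)=\int_{(-\infty,a]}\cdots\int_{(-\infty,a]}\Psi(x_n/t)\,(\delta_{x_{n-1}}\vartriangle_\alpha\nu)(dx_n)\cdots(\delta_{x_1}\vartriangle_\alpha\nu)(dx_2)\,\nu(dx_1)$ ($n$ integrations), i.e. $I(n,a,t)=\mathbb E\big[\Psi(X_n/t)\mathbf 1_{\{X_1\le a,\dots,X_n\le a\}}\big]$. *)

(* Defs.v *)
From HB Require Import structures.
From mathcomp Require Import all_boot all_order all_algebra.
From mathcomp Require Import all_classical all_reals all_analysis.
Set Implicit Arguments. Unset Strict Implicit. Unset Printing Implicit Defensive.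
Import Order.TTheory GRing.Theory Num.Theory.
Import numFieldNormedType.Exports.
Local Open Scope classical_set_scope.
Local Open Scope ring_scope.

Section Kendall.
Variables (R : realType) (alpha : R).

Definition Psi (t : R) : R := Num.max (1 - `|t| `^ alpha) 0.

Definition pareto_s (A : set R) : \bar R :=
  (\int[lebesgue_measure]_(y in A `&` [set y : R | (1 <= `|y|)%R])
     (alpha * `|y| `^ (- (2 * alpha) - 1))%:E)%E.

Definition dtilde (x : R) (A : set R) : \bar R :=
  ((2^-1)%:E * ((\1_A x)%:E + (\1_A (- x))%:E))%E.

Definition Tc (c : R) (lam : set R -> \bar R) (A : set R) : \bar R :=
  if c == 0 then (\1_A 0)%:E else lam [set y | A (c * y)].

(* tilde delta_x  Kendall-convolved with tilde delta_y *)
Definition kend_pts (x y : R) (A : set R) : \bar R :=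
  let M := Num.max `|x| `|y| in
  let m := Num.min `|x| `|y| in
  let rho := if M == 0 then 0 else m / M in
  ((rho `^ alpha)%:E * Tc M pareto_s A
   + (1 - rho `^ alpha)%:E * Tc M (dtilde 1) A)%E.

Definition kend_conv (nu1 nu2 : set R -> \bar R) (A : set R) : \bar R :=
  (\int[nu1]_x \int[nu2]_y kend_pts x y A)%E.

(* transition kernel  delta_x (Kendall) nu := tilde delta_x (Kendall) nu *)
Definition kend_kernel (nu : set R -> \bar R) (x : R) : set R -> \bar R :=
  kend_conv (dtilde x) nu.

Definition Fdf (nu : set R -> \bar R) (t : R) : R := fine (nu [set x : R | (x <= t)%R]).
Definition Gf (nu : set R -> \bar R) (t : R) : R :=
  fine (\int[nu]_x (Psi (x / t))%:E)%E.
Definition Hf (nu : set R -> \bar R) (t : R) : R :=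
  2 * Fdf nu t - 1 - Gf nu t.

Fixpoint Iinner (nu : set R -> \bar R) (a t : R) (k : nat) (x : R) : R :=
  match k with
  | O => Psi (x / t)
  | S k' => fine (\int[kend_kernel nu x]_(y in [set y : R | (y <= a)%R])
                    (Iinner nu a t k' y)%:E)%E
  end.

(* I(n,a,t), n >= 1 (n integrations: the first against nu) *)
Definition Ifun (nu : set R -> \bar R) (n : nat) (a t : R) : R :=
  fine (\int[nu]_(x in [set x : R | (x <= a)%R]) (Iinner nu a t n.-1 x)%:E)%E.

End Kendall.

(* Main.v *)
Require Import Defs.
From HB Require Import structures.
From mathcomp Require Import all_boot all_order all_algebra.
From mathcomp Require Import all_classical all_reals all_analysis.
From mathcomp Require Import measurable_realfun ring lra.
Import Order.TTheory GRing.Theory Num.Theory.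
Import numFieldNormedType.Exports.
Import HBNNSimple.
Local Open Scope classical_set_scope.
Local Open Scope ring_scope.

(** With X = |x|^alpha, Y = |y|^alpha, A = a^alpha, T = t^alpha and |x|, |y| <= a,
    integrating the Pareto density gives, for 0 < a <= t,
      int_{[-a,a]} Psi(z/t) (delta_x Kendall delta_y)(dz)
        = 1 - (X + Y)/T + X Y (2/(T A) - 1/A^2),
    while the integral vanishes as soon as |x| > a or |y| > a. Since this is affine in Y,
    integrating y against nu yields
      int_{[-a,a]} Psi(z/t) (delta_x Kendall nu)(dz)
        = 1_{|x| <= a} G(a) Psi(x/t) + H(a) Psi(a/t) Psi(x/a).
    For a symmetric measure and an even integrand, the integral over ]-oo, a] is the mean of
    the integrals over the line and over [-a, a]. So, with h = H(a) Psi(a/t), one killed step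
    of the walk preserves the span of f1 = Psi(./t), f2 = f1 1_{[-a,a]}, f3 = Psi(./a):
      f1 |-> (G(t) f1 + G(a) f2 + h f3)/2,   f2 |-> G(a) f2 + h f3,   f3 |-> G(a) f3.
    Iterating this triangular map on f1 and integrating against nu gives the formula. *)

(** * Integration against a density and against a symmetric measure *)

(** Monotone approximation by simple functions reduces the claim to level sets, where it is [mE].
    This is what turns integrals against the Pareto probability into Lebesgue integrals. *)
Lemma ge0_integral_density d (T : measurableType d) (R : realType)
    (mu m : {measure set T -> \bar R}) (g : T -> R) (D : set T) (f : T -> \bar R) :
  measurable_fun [set: T] g -> (forall x, 0 <= g x) ->
  (forall A, measurable A -> m A = \int[mu]_(x in A) (g x)%:E)%E ->
  measurable D -> measurable_fun D f -> (forall x, D x -> 0 <= f x)%E ->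
  (\int[m]_(x in D) f x = \int[mu]_(x in D) (f x * (g x)%:E))%E.
Proof.
move=> mg g0 mE mD mf f0.
pose h := nnsfun_approx mD mf.
have fE x : D x -> f x = limn (EFin \o h ^~ x).
  by move=> Dx; apply/esym/cvg_lim => //; exact: cvg_nnsfun_approx.
have mhg (n : nat) : measurable_fun D (fun x => (h n x)%:E * (g x)%:E)%E.
  by apply: emeasurable_funM; apply/measurable_EFinP; exact: measurable_funTS.
have step (n : nat) : (\int[m]_(x in D) (h n x)%:E =
    \int[mu]_(x in D) ((h n x)%:E * (g x)%:E))%E.
  transitivity (\int[m]_(x in D)
      (\sum_(y \in range (h n)) (y * \1_(h n @^-1` [set y]) x)%:E))%E.
    by apply: eq_integral => t tE; rewrite fimfunE -fsumEFin.
  rewrite ge0_integral_fsum//; last 2 first.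
    - move=> r; apply/measurable_EFinP/measurable_funM => //.
    - by move=> r x Dx; exact: nnfun_muleindic_ge0.
  transitivity (\int[mu]_(x in D)
      (\sum_(y \in range (h n)) ((y * \1_(h n @^-1` [set y]) x)%:E * (g x)%:E)))%E;
    last first.
    apply: eq_integral => t tE; rewrite [in RHS]fimfunE -fsumEFin//.
    by rewrite ge0_mule_fsuml// => r; exact: nnfun_muleindic_ge0.
  rewrite ge0_integral_fsum//; last 2 first.
    - move=> r; apply: emeasurable_funM; apply/measurable_EFinP.
        exact: measurable_funM.
      exact: measurable_funTS.
    - move=> r x Dx; rewrite mule_ge0//; first exact: nnfun_muleindic_ge0.
      by rewrite lee_fin.
  apply: eq_fsbigr => r; rewrite inE => -[x0 _ rE].
  have r0 : 0 <= r by rewrite -rE.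
  have mP : measurable (h n @^-1` [set r]) by [].
  under eq_integral do rewrite EFinM.
  under [RHS]eq_integral do rewrite EFinM -muleA.
  rewrite !ge0_integralZl//.
  (* By [mE], the [m]-mass of a level set inside [D] is the integral of [g] over it. *)
  - rewrite integral_indic// mE; last exact: measurableI.
    congr (_ * _)%E; rewrite setIC integral_mkcondr//.
    by apply: eq_integral => x _; rewrite epatch_indic muleC.
  - apply: emeasurable_funM; apply/measurable_EFinP => //.
    exact: measurable_funTS.
  - by move=> x _; rewrite mule_ge0// lee_fin.
  - by apply/measurable_EFinP; exact: measurable_indic.
transitivity (limn (fun n => \int[m]_(x in D) (h n x)%:E)%E).
  rewrite -monotone_convergence//.
  - by apply: eq_integral => x /[!inE] Dx; exact: fE.
  - by move=> n; apply/measurable_EFinP; exact: measurable_funTS.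
  - by move=> n x Dx; rewrite lee_fin.
  - by move=> x Dx a b ab; rewrite lee_fin; exact/lefP/nd_nnsfun_approx.
transitivity (limn (fun n => \int[mu]_(x in D) ((h n x)%:E * (g x)%:E))%E).
  by congr (limn _); apply/funext.
rewrite -monotone_convergence//.
- apply: eq_integral => x /[!inE] Dx; apply/cvg_lim => //.
  by apply: cvgeZr => //; exact: cvg_nnsfun_approx.
- by move=> n x Dx; rewrite mule_ge0// lee_fin.
- by move=> x Dx a b ab; rewrite lee_wpmul2r ?lee_fin//; exact/lefP/nd_nnsfun_approx.
Qed.

Section symmetric_measure.
Context {R : realType} (m : {measure set R -> \bar R}).
Hypothesis msym : forall A : set R, measurable A -> m (-%R @^-1` A) = m A.

(** The image of [m] under negation is [m] itself, so this is the change of variables for a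
    pushforward. *)
Lemma ge0_integral_sym (D : set R) (f : R -> \bar R) :
  measurable D -> measurable_fun D f -> (forall x, D x -> 0 <= f x)%E ->
  (\int[m]_(x in D) f x = \int[m]_(x in -%R @^-1` D) f (- x)%R)%E.
Proof.
move=> mD mf f0.
rewrite -(ge0_integral_pushforward (phi := (-%R : R -> R)))//.
- by apply: eq_measure_integral => A mA _; exact/esym/msym.
- by move=> x /[!inE]; exact: f0.
Qed.

(** Symmetry exchanges the ray []-oo, a]] with [[-a, +oo[]; together the two rays cover the line,
    and cover [[-a, a]] twice. The additive form avoids halving or subtracting possibly infinite
    integrals. *)
Lemma ge0_integral_even_ray (a : R) (f : R -> \bar R) : 0 <= a ->
  measurable_fun [set: R] f -> (forall x, 0 <= f x)%E ->
  (forall x, f (- x)%R = f x) ->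
  (\int[m]_(x in [set x : R | (x <= a)%R]) f x + \int[m]_(x in [set x : R | (x <= a)%R]) f x =
   \int[m]_x f x + \int[m]_(x in `[(- a)%R, a]) f x)%E.
Proof.
move=> a0 mf f0 fe.
have mfD D : measurable_fun D f by exact: measurable_funTS.
have mray : measurable [set x : R | (x <= a)%R] by rewrite -set_itvNyc.
have E1 : (\int[m]_(x in [set x : R | (x <= a)%R]) f x =
           \int[m]_(x in `]-oo, (- a)%R[) f x + \int[m]_(x in `[(- a)%R, a]) f x)%E.
  rewrite -ge0_integral_setU//=.
  - congr (integral _ _ _); apply/seteqP; split => x /=; rewrite !in_itv/=.
      by move=> xa; case: ltP => h; [left|right; rewrite xa].
    by case=> [|/andP[]]//; lra.
  - apply/disj_setPS => x []/=; rewrite !in_itv/= => xa /andP[]; lra.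
have E2 : (\int[m]_(x in [set x : R | (x <= a)%R]) f x =
           \int[m]_(x in `[(- a)%R, +oo[) f x)%E.
  rewrite ge0_integral_sym//.
  have -> : -%R @^-1` [set x : R | (x <= a)%R] = `[(- a)%R, +oo[%classic.
    by apply/seteqP; split => x /=; rewrite in_itv/= andbT; lra.
  by apply: eq_integral => x _; rewrite fe.
have E3 : (\int[m]_x f x =
     \int[m]_(x in `[(- a)%R, +oo[) f x + \int[m]_(x in `]-oo, (- a)%R[) f x)%E.
  rewrite -ge0_integral_setU//=.
  - congr (integral _ _ _); apply/seteqP; split => x //= _.
    by rewrite !in_itv/= andbT; case: ltP => h; [right|left].
  - by apply/disj_setPS => x []/=; rewrite !in_itv/= andbT; lra.
by rewrite {1}E2 E1 E3 addeA.
Qed.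

End symmetric_measure.

(* [lebesgue_measure] lives on [measurableTypeR R], which differs from [R] by its display. *)
Definition leb {R : realType} (A : set R) : \bar R := @lebesgue_measure R A.

HB.instance Definition _ (R : realType) := isMeasure.Build _ R R leb
  (measure0 (@lebesgue_measure R)) (measure_ge0 (@lebesgue_measure R))
  (@measure_semi_sigma_additive _ _ _ (@lebesgue_measure R)).

(** The identity from [measurableTypeR R] to [R] is measurable and pushes [lebesgue_measure] forward
    to [leb]. *)
Lemma ge0_integral_leb {R : realType} (D : set R) (h : R -> \bar R) :
  measurable D -> measurable_fun D h -> (forall x, 0 <= h x)%E ->
  (\int[leb]_(x in D) h x = \int[lebesgue_measure]_(x in D) h x)%E.
Proof.
move=> mD mh h0.
have mid : @measurable_fun _ _ (measurableTypeR R) R setT idfun.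
  by move=> _ A mA; rewrite setTI.
have h0' : {in D, forall x, 0 <= h x}%E by [].
rewrite -[RHS](ge0_integral_pushforward mid _ mD mh h0').
by apply: eq_measure_integral => A mA _.
Qed.

(** * The symmetric Pareto distribution *)

Section pareto.
Context {R : realType} (alpha : R).
Hypothesis alpha_gt0 : 0 < alpha.
Local Notation lambda := (@lebesgue_measure R).

Let is_derive_powR_comb (p q r s z : R) : 0 < z ->
  is_derive z 1 (fun z : R => p * z `^ r - q * z `^ s)
    (p * (r * z `^ (r - 1)) - q * (s * z `^ (s - 1))).
Proof.
move=> z0.
have h1 := is_derive1_powR r z0; have h2 := is_derive1_powR s z0.
exact: (is_deriveB (is_deriveZ p h1) (is_deriveZ q h2)).
Qed.

Let continuous_powR_comb (p q r s z : R) : 0 < z ->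
  {for z, continuous (fun z : R => p * z `^ r - q * z `^ s)}.
Proof.
move=> z0; apply: differentiable_continuous; apply/derivable1_diffP.
by have [] := is_derive_powR_comb p q r s z z0.
Qed.

(** Antiderivative, for [z > 0], of [1 - k z^alpha] times the Pareto density formula. The choice
    [k = c^alpha] serves [Psi (c * z)], and [k = 0] the total mass. *)
Definition pareto_prim (k z : R) := k * z `^ (- alpha) - 2^-1 * z `^ (- (2 * alpha)).

Let f (k z : R) :=
  alpha * z `^ (- (2 * alpha) - 1) - (alpha * k) * z `^ (- alpha - 1).

Let derive_prim (k z : R) : 0 < z -> is_derive z 1 (pareto_prim k) (f k z).
Proof.
move=> z0; apply: is_derive_eq; first exact: is_derive_powR_comb.
by rewrite /f; field.
Qed.

Lemma integral_pareto_itv (k b : R) : 1 <= b ->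
  (\int[lambda]_(z in `[1%R, b])
     (alpha * z `^ (- (2 * alpha) - 1) - (alpha * k) * z `^ (- alpha - 1))%:E =
   (pareto_prim k b - pareto_prim k 1)%:E)%E.
Proof.
rewrite le_eqVlt => /predU1P[<-|b1].
  by rewrite set_itv1 integral_set1 subrr.
have gt0 (z : R) : 1 <= z -> 0 < z by lra.
rewrite (@continuous_FTC2 _ (f k) (pareto_prim k)) ?EFinB//.
- apply: continuous_in_subspaceT => z; rewrite inE/= in_itv/= => /andP[z1 _].
  exact/continuous_powR_comb/gt0.
- split.
  + move=> z; rewrite in_itv/= => /andP[z1 _].
    by have [] := derive_prim k z (lt_trans ltr01 z1).
  + by apply/cvg_at_right_filter; exact: continuous_powR_comb.
  + by apply/cvg_at_left_filter; apply: continuous_powR_comb; exact/gt0/ltW.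
- move=> z; rewrite in_itv/= => /andP[z1 _].
  by rewrite derive1E; have [] := derive_prim k z (lt_trans ltr01 z1).
Qed.

(** For [x > 0] the power is [expR (- (p * ln x))], and [p * ln x] tends to infinity. *)
Lemma cvg_powRNy (p : R) : 0 < p -> x `^ (- p) @[x --> +oo%R] --> (0 : R).
Proof.
move=> p0.
apply: (@cvg_trans _ (expR (- (p * ln x)) @[x --> +oo%R])).
  apply: near_eq_cvg; near=> x.
  have x0 : 0 < x by near: x; exact: nbhs_pinfty_gt.
  by rewrite /powR gt_eqF// mulNr.
apply: (@cvg_comp _ _ _ (fun x : R => p * ln x) (fun z => expR (- z)) _ (pinfty_nbhs R)); last exact: cvgr_expR.
apply: gt0_cvgMry => //; apply/cvgryPge => A; near=> x.
have x0 : expR A <= x by near: x; exact: nbhs_pinfty_ge.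
by rewrite -(expRK A) ler_ln ?posrE ?expR_gt0// (lt_le_trans (expR_gt0 A)).
Unshelve. all: end_near. Qed.

Lemma integral_pareto_ray :
  (\int[lambda]_(z in `[1%R, +oo[) (alpha * z `^ (- (2 * alpha) - 1))%:E =
   (2^-1)%:E)%E.
Proof.
have fE z : f 0 z = alpha * z `^ (- (2 * alpha) - 1).
  by rewrite /f mulr0 mul0r subr0.
under eq_integral do rewrite -fE.
have gt0 (z : R) : 1 <= z -> 0 < z by lra.
(* The primitive tends to 0 at infinity and equals [-1/2] at 1. *)
rewrite (@ge0_continuous_FTC2y _ (f 0) (pareto_prim 0) 1 0).
- by rewrite /pareto_prim mul0r powR1 mulr1 sub0r -EFinB opprK add0r.
- by move=> z z1; rewrite fE mulr_ge0 ?powR_ge0// ltW.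
- apply: continuous_in_subspaceT => z; rewrite inE/= in_itv/= andbT => z1.
  exact/continuous_powR_comb/gt0.
- rewrite /pareto_prim -[X in _ --> X](subr0 0) -[X in _ --> _ - X](mulr0 2^-1).
  under eq_fun do rewrite mul0r.
  apply: cvgB; first exact: cvg_cst.
  by apply: cvgMr; apply: cvg_powRNy; rewrite mulr_gt0.
- by move=> z z1; have [] := derive_prim 0 z (lt_trans ltr01 z1).
- by apply/cvg_at_right_filter; exact: continuous_powR_comb.
- move=> z; rewrite in_itv/= andbT => z1.
  by rewrite derive1E; have [] := derive_prim 0 z (lt_trans ltr01 z1).
Qed.

Definition pareto_pdf (y : R) : R :=
  if 1 <= `|y| then alpha * `|y| `^ (- (2 * alpha) - 1) else 0.

Lemma pareto_pdf_ge0 (y : R) : 0 <= pareto_pdf y.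
Proof. by rewrite /pareto_pdf; case: ifP => // _; rewrite mulr_ge0 ?powR_ge0// ltW. Qed.

Lemma pareto_pdfN (y : R) : pareto_pdf (- y) = pareto_pdf y.
Proof. by rewrite /pareto_pdf normrN. Qed.

Lemma measurable_pareto_pdf : measurable_fun [set: R] pareto_pdf.
Proof.
apply: measurable_fun_ifT => //.
- by apply: measurable_fun_ler => //; exact: normr_measurable.
- apply: measurable_funM => //.
  by apply: (measurableT_comp (measurable_powR _)); exact: normr_measurable.
Qed.

(** The proof of [0 < alpha] is an argument so that the measure and probability structures, which
    rely on it, can be attached to this name. *)
Definition pareto_prob of 0 < alpha := @pareto_s R alpha.

Local Notation pareto := (pareto_prob alpha_gt0).

Lemma pareto_probE (A : set R) :
  pareto A = (\int[lambda]_(y in A) (pareto_pdf y)%:E)%E.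
Proof.
rewrite /pareto_prob /pareto_s integral_mkcondr; apply: eq_integral => y _.
rewrite /patch /pareto_pdf; case: ifPn => [|/negP]; rewrite inE/=.
  by move=> ->.
by move=> /negP/negbTE ->.
Qed.

Let pareto0 : pareto set0 = 0%E.
Proof. by rewrite pareto_probE integral_set0. Qed.

Let pareto_ge0 A : (0 <= pareto A)%E.
Proof. by rewrite pareto_probE integral_ge0// => x _; rewrite lee_fin pareto_pdf_ge0. Qed.

Let pareto_sigma_additive : semi_sigma_additive pareto.
Proof.
move=> F mF tF mUF; under eq_fun do under eq_bigr do rewrite pareto_probE.
rewrite pareto_probE; apply: cvg_toP.
  apply: ereal_nondecreasing_is_cvgn => m n mn.
  apply: lee_sum_nneg_natr => // k _ _; apply: integral_ge0 => x _.
  by rewrite lee_fin pareto_pdf_ge0.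
rewrite ge0_integral_bigcup//=.
- by apply/measurable_funTS/measurable_EFinP; exact: measurable_pareto_pdf.
- by move=> x _; rewrite lee_fin pareto_pdf_ge0.
Qed.

HB.instance Definition _ := isMeasure.Build _ _ R pareto
  pareto0 pareto_ge0 pareto_sigma_additive.

Let lebN (A : set R) : measurable A -> leb (-%R @^-1` A) = leb A.
Proof. by move=> mA; exact: lebesgue_measureN. Qed.

Let pareto_probE_leb (A : set R) : measurable A ->
  pareto A = (\int[leb]_(y in A) (pareto_pdf y)%:E)%E.
Proof.
move=> mA; rewrite ge0_integral_leb ?pareto_probE//.
- by apply/measurable_funTS/measurable_EFinP; exact: measurable_pareto_pdf.
- by move=> x; rewrite lee_fin pareto_pdf_ge0.
Qed.

Lemma pareto_prob_sym (A : set R) : measurable A -> pareto (-%R @^-1` A) = pareto A.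
Proof.
move=> mA.
have mNA : measurable (-%R @^-1` A).
  by rewrite -[_ @^-1` _]setTI; exact: oppr_measurable.
rewrite (pareto_probE_leb _ mNA) (pareto_probE_leb _ mA).
have mpdf : measurable_fun A (EFin \o pareto_pdf).
  by apply/measurable_funTS/measurable_EFinP; exact: measurable_pareto_pdf.
have pdf0 x : A x -> (0 <= (EFin \o pareto_pdf) x)%E.
  by move=> _; rewrite lee_fin pareto_pdf_ge0.
have /= -> := ge0_integral_sym leb lebN A (EFin \o pareto_pdf) mA mpdf pdf0.
by apply: eq_integral => x _; rewrite pareto_pdfN.
Qed.

(* The density vanishes on ]-1, 1[, and the two tails are exchanged by negation. *)
Lemma ge0_integral_pareto_even (D : set R) (h : R -> \bar R) :
  measurable D -> -%R @^-1` D = D -> measurable_fun [set: R] h ->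
  (forall x, 0 <= h x)%E -> (forall x, h (- x)%R = h x) ->
  (\int[pareto]_(z in D) h z =
   \int[lambda]_(z in D `&` `[1%R, +oo[)
       (h z * (alpha * z `^ (- (2 * alpha) - 1))%:E) +
   \int[lambda]_(z in D `&` `[1%R, +oo[)
       (h z * (alpha * z `^ (- (2 * alpha) - 1))%:E))%E.
Proof.
move=> mD DN mh h0 hN.
have mf : measurable_fun [set: R] (fun x => h x * (pareto_pdf x)%:E)%E.
  by apply: emeasurable_funM => //; apply/measurable_EFinP; exact: measurable_pareto_pdf.
have f0 x : (0 <= h x * (pareto_pdf x)%:E)%E by rewrite mule_ge0// lee_fin pareto_pdf_ge0.
rewrite (ge0_integral_density _ _ _ leb _ _ _ _ measurable_pareto_pdf pareto_pdf_ge0)//; last exact: measurable_funTS.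
have tails_disj (y : R) : 1 <= y -> y <= -1 -> False by lra.
pose U : set R := (D `&` `[1%R, +oo[) `|` (D `&` `]-oo, (-1)%R]).
transitivity (\int[leb]_(x in U) (h x * (pareto_pdf x)%:E))%E.
  rewrite [LHS]integral_mkcond [RHS]integral_mkcond; apply: eq_integral => x _.
  rewrite /patch; case: ifPn => [|/negP]; rewrite inE => xD.
    case: ifPn => // /negP; rewrite inE => xU.
    rewrite /pareto_pdf ifF ?mule0//; apply/negP => x1; apply: xU.
    by move: x1; rewrite ler_normr => /orP[x1|x1]; [left|right];
      split => //=; rewrite in_itv/= ?andbT//; lra.
  by rewrite ifF//; apply/negP; rewrite inE => -[[]|[]].
rewrite /U ge0_integral_setU//; last 4 first.
- exact: measurableI.
- exact: measurableI.
- exact: measurable_funTS.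
- apply/disj_setPS => x [[_ x1] [_ x2]]/=; move: x1 x2; rewrite /= !in_itv/= ?andbT => x1 x2.
  exact: (tails_disj x x1 x2).
have E1 : (\int[leb]_(x in D `&` `[1%R, +oo[) (h x * (pareto_pdf x)%:E) =
    \int[lambda]_(z in D `&` `[1%R, +oo[)
       (h z * (alpha * z `^ (- (2 * alpha) - 1))%:E))%E.
  rewrite ge0_integral_leb//; [|exact: measurableI|exact: measurable_funTS].
  apply: eq_integral => x; rewrite inE => -[_] /=; rewrite in_itv/= andbT => x1.
  by rewrite /pareto_pdf ger0_norm ?x1// (le_trans ler01 x1).
have E2 : (\int[leb]_(x in D `&` `]-oo, (-1)%R]) (h x * (pareto_pdf x)%:E) =
    \int[leb]_(x in D `&` `[1%R, +oo[) (h x * (pareto_pdf x)%:E))%E.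
  pose k x := (h x * (pareto_pdf x)%:E)%E.
  have mD' : measurable (D `&` `]-oo, (-1)%R]) by exact: measurableI.
  have mk : measurable_fun (D `&` `]-oo, (-1)%R]) k by exact: measurable_funTS.
  have k0 x : (D `&` `]-oo, (-1)%R]) x -> (0 <= k x)%E by move=> _; exact: f0.
  rewrite (ge0_integral_sym leb lebN _ k mD' mk k0).
  have -> : -%R @^-1` (D `&` `]-oo, (-1)%R]) = D `&` `[1%R, +oo[.
    rewrite preimage_setI DN; congr (_ `&` _).
    by apply/seteqP; split => x /=; rewrite !in_itv/= andbT; lra.
  by apply: eq_integral => x _; rewrite /k hN pareto_pdfN.
by rewrite E2 E1.
Qed.

Let pareto_setT : pareto [set: R] = 1%E.
Proof.
have := @ge0_integral_pareto_even [set: R] (cst 1%E) measurableT.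
rewrite preimage_setT integral_cst// mul1e => -> //.
rewrite setTI; under eq_integral do rewrite mul1e.
by rewrite integral_pareto_ray -EFinD; congr EFin; by field.
Qed.

HB.instance Definition _ := Measure_isProbability.Build _ _ R pareto pareto_setT.

(** * The function [Psi] and its truncated integral against the Pareto law *)

Lemma measurable_Psi : measurable_fun [set: R] (@Psi R alpha).
Proof.
apply: measurable_maxr => //; apply: measurable_funB => //.
by apply: (measurableT_comp (measurable_powR _)); exact: normr_measurable.
Qed.

Lemma Psi_ge0 (x : R) : 0 <= Psi alpha x.
Proof. by rewrite /Psi le_max lexx orbT. Qed.

Lemma Psi_le1 (x : R) : Psi alpha x <= 1.
Proof. by rewrite /Psi ge_max ler01 gerBl powR_ge0. Qed.

Lemma PsiN (x : R) : Psi alpha (- x) = Psi alpha x.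
Proof. by rewrite /Psi normrN. Qed.

Lemma Psi_le1E (x : R) : `|x| <= 1 -> Psi alpha x = 1 - `|x| `^ alpha.
Proof.
move=> x1; rewrite /Psi max_l// subr_ge0 -[leRHS](_ : 1 `^ alpha = 1); last by rewrite powR1.
by apply: ge0_ler_powR; rewrite ?nnegrE// ltW.
Qed.

Lemma Psi_ge1E (x : R) : 1 <= `|x| -> Psi alpha x = 0.
Proof.
move=> x1; rewrite /Psi max_r// subr_le0 -[leLHS](_ : 1 `^ alpha = 1); last by rewrite powR1.
by apply: ge0_ler_powR; rewrite ?nnegrE// ltW.
Qed.

Lemma integral_pareto_Psi (b c : R) : 1 <= b -> 0 <= c -> c * b <= 1 ->
  (\int[pareto]_(z in `[(- b)%R, b]) (Psi alpha (c * z))%:E =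
   (1 - b `^ (- (2 * alpha)) - 2 * c `^ alpha * (1 - b `^ (- alpha)))%:E)%E.
Proof.
move=> b1 c0 cb.
rewrite ge0_integral_pareto_even//; first last.
- by move=> x; rewrite mulrN PsiN.
- by move=> x; rewrite lee_fin Psi_ge0.
- apply/measurable_EFinP; apply: measurableT_comp; first exact: measurable_Psi.
  exact: measurable_funM.
- by apply/seteqP; split => x /=; rewrite !in_itv/=; lra.
have -> : `[(- b)%R, b] `&` `[1%R, +oo[ = `[1%R, b]%classic.
  by apply/seteqP; split => x /=; rewrite !in_itv/= ?andbT; lra.
have E1 : (\int[lambda]_(z in `[1%R, b])
    ((Psi alpha (c * z))%:E * (alpha * z `^ (- (2 * alpha) - 1))%:E) =
    (pareto_prim (c `^ alpha) b - pareto_prim (c `^ alpha) 1)%:E)%E.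
  rewrite -integral_pareto_itv//; apply: eq_integral => z.
  rewrite inE/= in_itv/= => /andP[z1 zb].
  have z0 : 0 < z by lra.
  have cz0 : 0 <= c * z by rewrite mulr_ge0// ltW.
  rewrite Psi_le1E ger0_norm//; last by rewrite (le_trans _ cb)// ler_wpM2l.
  rewrite powRM ?(ltW z0)// -EFinM; congr EFin.
  have -> : z `^ (- alpha - 1) = z `^ alpha * z `^ (- (2 * alpha) - 1).
    rewrite -powRD; last by rewrite (gt_eqF z0) implybT.
    by congr (powR z _); ring.
  by ring.
rewrite E1 -EFinD /pareto_prim !powR1; congr EFin; by field.
Qed.

End pareto.

(** * Kendall convolution as a Markov kernel *)

Section kscale.
Context d d' (X : measurableType d) (Y : measurableType d') (R : realType).
Variables (k : R.-pker X ~> Y) (p : X -> R).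
Hypotheses (p_ge0 : forall x, 0 <= p x) (p_le1 : forall x, p x <= 1)
  (mp : measurable_fun [set: X] p).

(** Lets the mixture in the Kendall convolution be a sum of weighted kernels. The bound and the
    measurability of the weight are arguments because the kernel structures rely on them. *)
Definition kscale of (forall x, p x <= 1) & measurable_fun [set: X] p :
    X -> {measure set Y -> \bar R} :=
  fun x => mscale (NngNum (p_ge0 x)) (k x).

Let measurable_kscale U : measurable U ->
  measurable_fun [set: X] (kscale p_le1 mp ^~ U).
Proof.
move=> mU; rewrite /kscale/= /mscale/=.
by apply: emeasurable_funM; [exact/measurable_EFinP|exact: measurable_kernel].
Qed.

HB.instance Definition _ :=
  isKernel.Build _ _ _ _ _ (kscale p_le1 mp) measurable_kscale.

Let kscale_uub : measure_fam_uub (kscale p_le1 mp).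
Proof.
(* The uniform bound has to be strict while the mass [p x] may equal 1, hence the constant 2. *)
exists 2 => x; rewrite /kscale/= /mscale/= prob_kernel mule1 lte_fin.
by rewrite (le_lt_trans (p_le1 x))// ltr1n.
Qed.

HB.instance Definition _ :=
  Kernel_isFinite.Build _ _ _ _ _ (kscale p_le1 mp) kscale_uub.

End kscale.
Arguments kscale {d d' X Y R} k p p_ge0 _ _.

(** Presents a fixed probability as a kernel, so that integrating against it becomes a kernel
    composition [mkcomp]. *)
Definition kconst d d' (X : measurableType d) (Y : measurableType d')
    (R : realType) (P : probability Y R) : X -> {measure set Y -> \bar R} :=
  kprobability (@measurable_cst _ _ X (pprobability Y R) setT (P : pprobability Y R)).

HB.instance Definition _ d d' (X : measurableType d) (Y : measurableType d')
  (R : realType) (P : probability Y R) := ProbabilityKernel.on (@kconst _ _ X Y R P).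

Section kendall_kernel.
Context {R : realType} (alpha : R).
Hypothesis alpha_gt0 : 0 < alpha.
Local Notation pareto := (pareto_prob alpha alpha_gt0).

Definition kmax (u : R * R) : R := Num.max `|u.1| `|u.2|.
Definition kmin (u : R * R) : R := Num.min `|u.1| `|u.2|.
Definition kweight (u : R * R) : R := (kmin u / kmax u) `^ alpha.

Lemma kmax_ge0 u : 0 <= kmax u.
Proof. by rewrite /kmax le_max normr_ge0. Qed.

Lemma kmin_ge0 u : 0 <= kmin u.
Proof. by rewrite /kmin le_min !normr_ge0. Qed.

Lemma kmin_le_kmax u : kmin u <= kmax u.
Proof. by rewrite /kmin /kmax ge_min !le_max lexx. Qed.

Lemma kweight_ge0 u : 0 <= kweight u.
Proof. exact: powR_ge0. Qed.

Lemma kweight_le1 u : kweight u <= 1.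
Proof.
rewrite /kweight -[leRHS](_ : 1 `^ alpha = 1); last by rewrite powR1.
have r1 : kmin u / kmax u <= 1.
  have := kmax_ge0 u; rewrite le_eqVlt => /predU1P[<-|M0].
    by rewrite invr0 mulr0.
  by rewrite ler_pdivrMr// mul1r kmin_le_kmax.
apply: ge0_ler_powR; rewrite ?nnegrE ?ler01 ?(ltW alpha_gt0)//.
by rewrite divr_ge0// ?kmin_ge0// kmax_ge0.
Qed.

Lemma kweight_kmax0 u : kmax u = 0 -> kweight u = 0.
Proof.
by move=> M0; rewrite /kweight M0 invr0 mulr0 powR0// gt_eqF.
Qed.

Let mnorm1 : measurable_fun [set: R * R] (fun u => `|u.1|).
Proof. by apply: measurableT_comp => //; exact: normr_measurable. Qed.

Let mnorm2 : measurable_fun [set: R * R] (fun u => `|u.2|).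
Proof. by apply: measurableT_comp => //; exact: normr_measurable. Qed.

Lemma measurable_kmax : measurable_fun [set: R * R] kmax.
Proof. exact: measurable_maxr. Qed.

Lemma measurable_kmin : measurable_fun [set: R * R] kmin.
Proof. exact: measurable_minr. Qed.

Lemma measurable_kweight : measurable_fun [set: R * R] kweight.
Proof.
apply: (measurableT_comp (measurable_powR alpha)).
apply: measurable_funM; first exact: measurable_kmin.
(* The inverse becomes the power [-1], valid since [kmax] is nonnegative, so that measurability of
   powers applies. *)
rewrite (_ : (fun x => _) = (fun u => kmax u `^ (-1))); last first.
  by apply/funext => u; rewrite powR_inv1// kmax_ge0.
by apply: (measurableT_comp (measurable_powR (-1))); exact: measurable_kmax.
Qed.

Let onem_ge0 u : 0 <= (1 - kweight u) / 2.
Proof. by rewrite divr_ge0// subr_ge0 kweight_le1. Qed.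

Let onem_le1 u : (1 - kweight u) / 2 <= 1.
Proof. have := kweight_ge0 u; have := kweight_le1 u; lra. Qed.

Let measurable_onem : measurable_fun [set: R * R] (fun u => (1 - kweight u) / 2).
Proof.
by apply: measurable_funM => //; apply: measurable_funB => //; exact: measurable_kweight.
Qed.

Let measurable_dilate :
  measurable_fun [set: (R * R) * R] (fun w : (R * R) * R => kmax w.1 * w.2).
Proof.
apply: measurable_funM => //.
by apply: (measurableT_comp measurable_kmax).
Qed.

Let measurable_kmaxN : measurable_fun [set: R * R] (fun u => - kmax u).
Proof. by apply: (measurableT_comp (@oppr_measurable _ setT)); exact: measurable_kmax. Qed.

(** The law of [kmax u * Z] with [Z] symmetric Pareto. Composing a constant kernel with a Dirac
    kernel yields measurability in [u]. *)
Definition kdilate : (R * R)%type -> {measure set R -> \bar R} :=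
  mkcomp (@kconst _ _ (R * R)%type R R pareto) (kdirac measurable_dilate).

HB.instance Definition _ := SFiniteKernel.on kdilate.

Let kdilate_prob u : kdilate u setT = 1%E.
Proof.
rewrite /kdilate /mkcomp/= /kcomp.
under eq_integral do rewrite prob_kernel.
by rewrite integral_cst// mul1e; exact: (probability_setT pareto).
Qed.

HB.instance Definition _ :=
  Kernel_isProbability.Build _ _ _ _ _ kdilate kdilate_prob.

Lemma ge0_integral_kdilate u (f : R -> \bar R) :
  measurable_fun [set: R] f -> (forall z, 0 <= f z)%E ->
  (\int[kdilate u]_z f z = \int[pareto]_z f (kmax u * z)%R)%E.
Proof.
move=> mf f0; have := integral_kcomp
  (@kconst _ _ (R * R)%type R R pareto) (kdirac measurable_dilate) u f0 mf.
move=> -> /=; apply: eq_integral => z _.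
by rewrite /kdirac integral_dirac// diracT mul1e.
Qed.

(* On measurable sets, [kend_ker (x, y)] is [kend_pts alpha x y] and [kend_step x] is
   [kend_kernel alpha nu x]; the values on other sets do not matter for integrals. *)
Definition kend_ker : (R * R)%type -> {measure set R -> \bar R} :=
  kadd (kscale kdilate kweight kweight_ge0 kweight_le1 measurable_kweight)
    (kadd
      (kscale (kdirac measurable_kmax) _ onem_ge0 onem_le1 measurable_onem)
      (kscale (kdirac measurable_kmaxN) _ onem_ge0 onem_le1 measurable_onem)).

HB.instance Definition _ := SFiniteKernel.on kend_ker.

Lemma ge0_integral_kend_ker u (f : R -> \bar R) :
  measurable_fun [set: R] f -> (forall z, 0 <= f z)%E ->
  (\int[kend_ker u]_z f z =
   (kweight u)%:E * (\int[pareto]_z f (kmax u * z)%R) +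
   ((1 - kweight u) / 2)%:E * (f (kmax u) + f (- kmax u)%R))%E.
Proof.
move=> mf f0.
rewrite /kend_ker /kadd !ge0_integral_measure_add//.
rewrite /kscale !ge0_integral_mscale// ge0_integral_kdilate// /kdirac /= !integral_dirac// !diracT !mul1e.
by rewrite -ge0_muleDr.
Qed.

(* If max(|x|, |y|) = 0 the weight of the Pareto part vanishes, so that the junk value of
   [kmin / kmax] and the special case of [Tc] are harmless. *)
Lemma kend_kerE (x y : R) (A : set R) : measurable A ->
  kend_ker (x, y) A = kend_pts alpha x y A.
Proof.
move=> mA.
have := @ge0_integral_kend_ker (x, y) (fun z => (\1_A z)%:E).
rewrite integral_indic// setIT => ->; last 2 first.
- by apply/measurable_EFinP; exact: measurable_indic.
- by move=> z; rewrite lee_fin.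
rewrite /kend_pts -/(kmax (x, y)) -/(kmin (x, y)).
have [M0|M0] := eqVneq (kmax (x, y)) 0.
  rewrite kweight_kmax0// M0 !mul0e powR0 ?gt_eqF// /Tc eqxx !mul0e !add0e.
  by rewrite subr0 mul1e oppr0 -EFinD -EFinM; congr EFin; field.
rewrite -/(kweight (x, y)) /Tc (negbTE M0).
congr (_ * _ + _)%E.
  set B := [set z | _]; have mB : measurable B.
    have mc : measurable_fun [set: R] (fun z => kmax (x, y) * z).
      exact: measurable_funM.
    by rewrite -[B]setTI; exact: mc.
  have := integral_indic pareto measurableT mB; rewrite setIT => pB.
  by transitivity (pareto B) => //; rewrite -pB; apply: eq_integral => z _; rewrite !indicE.
rewrite /dtilde EFinM -muleA; congr (_ * _)%E.
have inB c : (c \in [set z | A (kmax (x, y) * z)]) = (kmax (x, y) * c \in A) by [].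
by rewrite !indicE !inB mulr1 mulrN1.
Qed.

Lemma kend_ptsN (x y : R) (A : set R) :
  kend_pts alpha (- x) y A = kend_pts alpha x y A.
Proof. by rewrite /kend_pts normrN. Qed.

Variable nu : probability R R.

Definition kend_step : R -> {measure set R -> \bar R} :=
  mkcomp (@kconst _ _ R R R nu) kend_ker.

HB.instance Definition _ := SFiniteKernel.on kend_step.

(** [kend_kernel] averages over the two atoms of [dtilde x], at [x] and [- x]. Since [kend_pts]
    depends on [x] through its absolute value only, both atoms contribute the same. *)
Lemma kend_stepE (x : R) (A : set R) : measurable A ->
  kend_kernel alpha nu x A = kend_step x A.
Proof.
move=> mA.
have hE x' : (\int[nu]_y kend_pts alpha x' y A = kend_step x' A)%E.
  by apply: eq_integral => y _; rewrite kend_kerE.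
rewrite /kend_kernel /kend_conv.
have half0 : 0 <= (2^-1 : R) by rewrite invr_ge0.
pose dd : {measure set R -> \bar R} := measure_add (dirac x) (dirac (- x)%R).
have -> : dtilde x = mscale (NngNum half0) dd.
  by apply/funext => B; congr (_ * _)%E; exact/esym/measure_addE.
under eq_integral do rewrite hE.
have mh : measurable_fun [set: R] (fun x' => kend_step x' A).
  exact: measurable_kernel.
rewrite ge0_integral_mscale// /dd ge0_integral_measure_add// !integral_dirac//.
rewrite !diracT !mul1e.
have -> : kend_step (- x) A = kend_step x A.
  by rewrite -!hE; apply: eq_integral => y _; rewrite kend_ptsN.
rewrite -mule2n -mule_natl muleA -EFinM mulVf ?pnatr_eq0// mul1e//.
Qed.

(** [kend_kernel] is a bare set function. Its integrals are suprema over simple functions, whose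
    integrals evaluate it only on level sets; these are measurable, so [kend_stepE] applies. *)
Lemma integral_kend_kernel (x : R) (D : set R) (f : R -> \bar R) :
  (\int[kend_kernel alpha nu x]_(z in D) f z = \int[kend_step x]_(z in D) f z)%E.
Proof.
have sE (h : {nnsfun R >-> R}) :
    sintegral (kend_kernel alpha nu x) h = sintegral (kend_step x) h.
  by apply: eq_fsbigr => r _; rewrite kend_stepE.
rewrite /integral; congr (ereal_sup _ - ereal_sup _)%E;
  by apply/seteqP; split => _ [h hf <-]; exists h => //; rewrite sE.
Qed.

Lemma ge0_integral_kend_step (x : R) (f : R -> \bar R) :
  measurable_fun [set: R] f -> (forall z, 0 <= f z)%E ->
  (\int[kend_step x]_z f z = \int[nu]_y \int[kend_ker (x, y)]_z f z)%E.
Proof. by move=> mf f0; rewrite [LHS]integral_kcomp. Qed.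

Lemma kend_step_setT (x : R) : kend_step x [set: R] = 1%E.
Proof.
rewrite -[LHS]mul1e -integral_cst// ge0_integral_kend_step//.
rewrite (eq_integral (cst 1%E)); first by rewrite integral_cst// mul1e; exact: (probability_setT nu).
move=> y _; rewrite ge0_integral_kend_ker// integral_cst// mul1e.
rewrite [X in (_ * X + _)%E](_ : _ = 1%E); last exact: (probability_setT pareto).
rewrite /= mule1 (_ : (1 + 1)%E = 2%:E :> \bar R); last by rewrite -EFinD.
by rewrite -EFinM -EFinD; congr EFin; field.
Qed.

HB.instance Definition _ :=
  Kernel_isProbability.Build _ _ _ _ _ kend_step kend_step_setT.

(** Negation preserves the dilated Pareto part and exchanges the atoms at [kmax] and [- kmax], which
    have equal weight. *)
Lemma kend_step_sym (x : R) (A : set R) : measurable A ->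
  kend_step x (-%R @^-1` A) = kend_step x A.
Proof.
move=> mA.
have mNA : measurable (-%R @^-1` A).
  by rewrite -[_ @^-1` _]setTI; exact: oppr_measurable.
rewrite -(setIT (-%R @^-1` A)) -[in RHS](setIT A) -!integral_indic//.
have m1 : measurable_fun [set: R] (fun z => (\1_A z)%:E : \bar R).
  by apply/measurable_EFinP; exact: measurable_indic.
have m2 : measurable_fun [set: R] (fun z => (\1_(-%R @^-1` A) z)%:E : \bar R).
  by apply/measurable_EFinP; exact: measurable_indic.
have p1 z : (0 <= (\1_A z)%:E :> \bar R)%E by rewrite lee_fin.
have p2 z : (0 <= (\1_(-%R @^-1` A) z)%:E :> \bar R)%E by rewrite lee_fin.
rewrite (ge0_integral_kend_step x _ m1 p1) (ge0_integral_kend_step x _ m2 p2).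
apply: eq_integral => y _.
rewrite (ge0_integral_kend_ker (x, y) _ m1 p1) (ge0_integral_kend_ker (x, y) _ m2 p2).
have NE z : \1_(-%R @^-1` A) z = \1_A (- z) :> R by rewrite !indicE.
rewrite !NE opprK [X in (_ + _ * X)%E]addeC; congr (_ * _ + _)%E.
set M := kmax _.
have mM : measurable_fun [set: R] (fun z => (\1_A (M * z))%:E : \bar R).
  by apply: (measurableT_comp m1); exact: measurable_funM.
have M0 z : [set: R] z -> (0 <= (\1_A (M * z) : R)%:E)%E by rewrite lee_fin.
have := ge0_integral_sym pareto (pareto_prob_sym _ alpha_gt0) setT _ measurableT mM M0.
rewrite preimage_setT => ->; apply: eq_integral => z _.
by rewrite NE mulrN.
Qed.

End kendall_kernel.

(** * Truncated integrals of Psi *)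

Section cut_profile.
Context {R : realType} (alpha : R).
Hypothesis alpha_gt0 : 0 < alpha.
Local Notation pareto := (pareto_prob alpha alpha_gt0).
Local Notation Psi := (Psi alpha).

(* [cut_Psi t t], [cut_Psi a t], [cut_Psi a a] are the functions f1, f2, f3 of the header. *)
Definition cut_Psi (a t x : R) : R := if `|x| <= a then Psi (x / t) else 0.

Lemma cut_Psi_ge0 a t x : 0 <= cut_Psi a t x.
Proof. by rewrite /cut_Psi; case: ifP => // _; exact: Psi_ge0. Qed.

Lemma cut_Psi_le1 a t x : cut_Psi a t x <= 1.
Proof. by rewrite /cut_Psi; case: ifP => // _; exact: Psi_le1. Qed.

Lemma cut_PsiN a t x : cut_Psi a t (- x) = cut_Psi a t x.
Proof. by rewrite /cut_Psi normrN mulNr PsiN. Qed.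

Lemma measurable_cut_Psi a t : measurable_fun [set: R] (cut_Psi a t).
Proof.
apply: measurable_fun_ifT => //.
  by apply: measurable_fun_ler => //; exact: normr_measurable.
apply: (measurableT_comp (measurable_Psi alpha)).
exact: measurable_funM.
Qed.

Lemma cut_Psi_id t x : 0 < t -> cut_Psi t t x = Psi (x / t).
Proof.
move=> t0; rewrite /cut_Psi; case: leP => // tx.
by rewrite Psi_ge1E// normrM normfV (gtr0_norm t0) ler_pdivlMr// mul1r ltW.
Qed.

Lemma powR_div (x y p : R) : 0 <= x -> 0 <= y -> (x / y) `^ p = x `^ p / y `^ p.
Proof.
move=> x0 y0; rewrite powRM ?invr_ge0//; congr (_ * _).
by rewrite -powR_inv1// -powRrM mulN1r powRN.
Qed.

Lemma powRN2 (x p : R) : x `^ (- (2 * p)) = (x `^ p) ^- 2.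
Proof. by rewrite powRN mulrC powRrM powR_mulrn// powR_ge0. Qed.

Lemma Psi_div (x t : R) : 0 < t -> `|x| <= t ->
  Psi (x / t) = 1 - `|x| `^ alpha / t `^ alpha.
Proof.
move=> t0 xt; rewrite Psi_le1E// normrM normfV (gtr0_norm t0).
  by rewrite powR_div// ltW.
by rewrite ler_pdivrMr// mul1r.
Qed.

Lemma kmaxE (x y : R) : kmax (x, y) = Num.max `|x| `|y|. Proof. by []. Qed.

(** The minimum and maximum are the two absolute values in some order, so symmetric expressions in
    them need no case distinction later. *)
Lemma kmin_kmax_powR (x y p : R) :
  (kmin (x, y) `^ p + kmax (x, y) `^ p = `|x| `^ p + `|y| `^ p) *
  (kmin (x, y) `^ p * kmax (x, y) `^ p = `|x| `^ p * `|y| `^ p).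
Proof.
by rewrite /kmin /kmax /=; case: (leP `|x| `|y|) => _; split => //; [rewrite addrC|rewrite mulrC].
Qed.

(** The Pareto law lives on [|z| >= 1], where [|M z| >= M > a]. *)
Let pareto_dilate0 (a t M : R) : 0 < a -> a < M ->
  (\int[pareto]_z (cut_Psi a t (M * z))%:E = 0)%E.
Proof.
move=> a0 aM; have M0 : 0 < M by exact: lt_trans aM.
rewrite ge0_integral_pareto_even//; first last.
- by move=> x; rewrite mulrN cut_PsiN.
- by move=> x; rewrite lee_fin cut_Psi_ge0.
- apply/measurable_EFinP; apply: (measurableT_comp (measurable_cut_Psi a t)).
  exact: measurable_funM.
rewrite setTI [X in (X + _)%E](_ : _ = 0%E) ?[X in (_ + X)%E](_ : _ = 0%E) ?adde0//;
  apply: integral0_eq => z; rewrite /= in_itv/= andbT => z1;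
  have Mz : M <= M * z by rewrite ler_peMr// ltW.
all: rewrite /cut_Psi ifF ?mul0e//; apply/negbTE; rewrite -ltNge.
all: by rewrite ger0_norm ?(lt_le_trans aM)// (le_trans (ltW M0)).
Qed.

(** The cutoff [|M z| <= a] is [|z| <= a / M], so [integral_pareto_Psi] applies with [b = a / M] and
    [c = M / t]; its condition [c * b <= 1] is then [a <= t]. *)
Let pareto_dilate (a t M : R) : 0 < a -> a <= t -> 0 < M -> M <= a ->
  (\int[pareto]_z (cut_Psi a t (M * z))%:E =
   (1 - (M `^ alpha / a `^ alpha) ^+ 2
      - 2 * (M `^ alpha / t `^ alpha) * (1 - M `^ alpha / a `^ alpha))%:E)%E.
Proof.
move=> a0 aT M0 Ma.
have t0 : 0 < t by exact: lt_le_trans aT.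
have b1 : 1 <= a / M by rewrite ler_pdivlMr// mul1r.
have c0 : 0 <= M / t by rewrite divr_ge0// ltW.
have cb : M / t * (a / M) <= 1.
  have -> : M / t * (a / M) = a / t by field; rewrite !gt_eqF.
  by rewrite ler_pdivrMr// mul1r.
have := integral_pareto_Psi alpha alpha_gt0 (a / M) (M / t) b1 c0 cb.
rewrite powRN2 powRN !powR_div ?(ltW M0) ?(ltW a0) ?(ltW t0)//.
rewrite !invf_div expr_div_n.
have -> : (\int[pareto]_(z in `[(- (a / M))%R, (a / M)%R]) (Psi (M / t * z))%:E =
    \int[pareto]_z (cut_Psi a t (M * z))%:E)%E.
  rewrite integral_mkcond; apply: eq_integral => z _.
  have -> : cut_Psi a t (M * z) = if `|z| <= a / M then Psi (M / t * z) else 0.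
    by rewrite /cut_Psi normrM (gtr0_norm M0) ler_pdivlMr// (mulrC `|z|) (mulrAC M z).
  rewrite /patch; case: ifPn => [|/negP]; rewrite inE/= in_itv/= -ler_norml.
    by move=> ->.
  by move=> /negP/negbTE ->.
by move=> ->; congr EFin; rewrite -expr_div_n -!exprVn ?invf_div.
Qed.

(** If the maximum exceeds [a], the atoms and the Pareto part all lie outside [[-a, a]]. Otherwise
    the denominators coming from the weight cancel, leaving a symmetric polynomial in the [alpha]-th
    powers of the minimum and maximum. *)
Lemma integral_kend_ker_cut_Psi (a t x y : R) : 0 < a -> a <= t ->
  (\int[kend_ker alpha alpha_gt0 (x, y)]_z (cut_Psi a t z)%:E =
   (if (`|x| <= a) && (`|y| <= a) then
      1 - (`|x| `^ alpha + `|y| `^ alpha) / t `^ alpha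
        + `|x| `^ alpha * `|y| `^ alpha
          * (2 / (t `^ alpha * a `^ alpha) - (a `^ alpha) ^- 2)
    else 0)%:E)%E.
Proof.
move=> a0 aT; have t0 : 0 < t by exact: lt_le_trans aT.
rewrite ge0_integral_kend_ker; first last.
- by move=> z; rewrite lee_fin cut_Psi_ge0.
- by apply/measurable_EFinP; exact: measurable_cut_Psi.
rewrite cut_PsiN -EFinD.
have MaE : (kmax (x, y) <= a) = (`|x| <= a) && (`|y| <= a) by rewrite kmaxE ge_max.
rewrite -MaE; have [Ma|aM] := leP (kmax (x, y)) a; last first.
  rewrite pareto_dilate0// mule0 add0e -EFinM /cut_Psi.
  by rewrite (ger0_norm (kmax_ge0 (x, y))) leNgt aM /= addr0 mulr0.
(* If the maximum is 0 then [x = y = 0], the kernel is the point mass at 0 and both sides equal 1;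
   the general computation divides by the maximum. *)
have [M0|M0] := eqVneq (kmax (x, y)) 0.
  have m0 : kmin (x, y) = 0.
    by apply/eqP; rewrite eq_le kmin_ge0 andbT -[leRHS]M0 kmin_le_kmax.
  rewrite kweight_kmax0// mul0e add0e -EFinM M0; congr EFin.
  rewrite -!kmin_kmax_powR M0 m0 powR0 ?gt_eqF//.
  rewrite /cut_Psi normr0 (ltW a0) mul0r Psi_le1E ?normr0 ?ler01// powR0 ?gt_eqF//.
  by field; rewrite !gt_eqF ?powR_gt0.
have {}M0 : 0 < kmax (x, y) by rewrite lt_def M0 kmax_ge0.
rewrite pareto_dilate// -!EFinM -EFinD; congr EFin.
rewrite /cut_Psi (gtr0_norm M0) Ma Psi_div// ?(gtr0_norm M0) ?(le_trans Ma)//.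
rewrite -!kmin_kmax_powR /kweight powR_div ?kmin_ge0 ?kmax_ge0//.
by field; rewrite !gt_eqF ?powR_gt0.
Qed.

End cut_profile.

(** * Integrals of the cut functions against [nu] and against one step of the walk *)

Lemma bounded_integrable d (T : measurableType d) (R : realType)
    (m : {measure set T -> \bar R}) (D : set T) (f : T -> R) (M : R) :
  measurable D -> (m setT < +oo)%E -> measurable_fun [set: T] f ->
  (forall x, `|f x| <= M) -> m.-integrable D (EFin \o f).
Proof.
move=> mD moo mf fM; apply: measurable_bounded_integrable => //.
- by rewrite (le_lt_trans _ moo)// le_measure// inE.
- exact: measurable_funTS.
- exists M; split; first exact: num_real.
  by move=> y My x _; exact: le_trans (fM x) (ltW My).
Qed.

Section cut_integrals.
Context {R : realType} (alpha : R).
Hypothesis alpha_gt0 : 0 < alpha.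
Local Notation Psi := (Psi alpha).
Local Notation cut := (cut_Psi alpha).

Definition cut_int (m : set R -> \bar R) (a t : R) : R :=
  fine (\int[m]_x (cut a t x)%:E)%E.

Lemma cut_Psi_integrable (m : {measure set R -> \bar R}) (D : set R) (a t : R) :
  (m setT < +oo)%E -> measurable D -> m.-integrable D (EFin \o cut a t).
Proof.
move=> moo mD; apply: (bounded_integrable _ _ _ _ _ _ 1) => //.
  exact: measurable_cut_Psi.
by move=> x; rewrite ger0_norm ?cut_Psi_ge0// cut_Psi_le1.
Qed.

Section ray.
Variable m : {measure set R -> \bar R}.
Hypotheses (moo : (m setT < +oo)%E)
  (msym : forall A : set R, measurable A -> m (-%R @^-1` A) = m A).

(** Since [a <= b], [cut b t] agrees with [cut a t] on [[-a, a]], and [ge0_integral_even_ray] gives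
    the mean. All integrals are finite, which permits passing to [fine]. *)
Lemma ray_cut_Psi (a b t : R) : 0 < a -> a <= b ->
  (\int[m]_(x in [set x : R | (x <= a)%R]) cut b t x)%R =
  (cut_int m b t + cut_int m a t) / 2.
Proof.
move=> a0 ab.
have mray : measurable [set x : R | x <= a] by rewrite -set_itvNyc.
have := ge0_integral_even_ray m msym a (EFin \o cut b t) (ltW a0).
have mc : measurable_fun [set: R] (EFin \o cut b t).
  by apply/measurable_EFinP; exact: measurable_cut_Psi.
have c0 x : (0 <= (EFin \o cut b t) x)%E by rewrite lee_fin cut_Psi_ge0.
have cN x : (EFin \o cut b t) (- x) = (EFin \o cut b t) x by rewrite /= cut_PsiN.
move=> /(_ mc c0 cN).
have -> : (\int[m]_(x in `[(- a)%R, a]) (EFin \o cut b t) x =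
           \int[m]_x (cut a t x)%:E)%E.
  rewrite integral_mkcond; apply: eq_integral => x _.
  rewrite /patch /= /cut_Psi; case: ifPn => [|/negP]; rewrite inE/= in_itv/= -ler_norml.
    by move=> xa; rewrite xa (le_trans xa).
  by move=> /negP/negbTE ->.
have fin D s : measurable D -> (\int[m]_(x in D) (cut s t x)%:E)%E \is a fin_num.
  by move=> mD; apply: (integrable_fin_num mD); exact: cut_Psi_integrable.
move=> E0; have f1 := fin _ b mray.
have f2 := fin setT b measurableT; have f3 := fin setT a measurableT.
have E : (\int[m]_(x in [set x : R | (x <= a)%R]) cut b t x)%R +
    (\int[m]_(x in [set x : R | (x <= a)%R]) cut b t x)%R = cut_int m b t + cut_int m a t.
  by rewrite /cut_int /Rintegral -(fineD f1 f1) -(fineD f2 f3); congr fine.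
by rewrite -E; field.
Qed.

Lemma ray_cut_Psi_comb (a t c d e : R) : 0 < a -> a <= t ->
  fine (\int[m]_(x in [set x : R | (x <= a)%R])
     (c * cut t t x + d * cut a t x + e * cut a a x)%:E)%E =
  c * ((cut_int m t t + cut_int m a t) / 2) + d * cut_int m a t + e * cut_int m a a.
Proof.
move=> a0 aT.
have mray : measurable [set x : R | x <= a] by rewrite -set_itvNyc.
have ci b s k : m.-integrable [set x : R | x <= a] (EFin \o (fun x => k * cut b s x)).
  apply: (bounded_integrable _ _ _ _ _ _ `|k|) => //.
    by apply: measurable_funM => //; exact: measurable_cut_Psi.
  by move=> x; rewrite normrM (ger0_norm (cut_Psi_ge0 _ _ _ x)) ler_piMr// cut_Psi_le1.
rewrite -[LHS]/(\int[m]_(x in [set x : R | (x <= a)%R])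
     (c * cut t t x + d * cut a t x + e * cut a a x))%R.
rewrite RintegralD//; last exact: (integrableD mray (ci t t c) (ci a t d)).
rewrite RintegralD// !RintegralZl//; try exact: cut_Psi_integrable.
rewrite !ray_cut_Psi//.
by move: (cut_int m t t) (cut_int m a t) (cut_int m a a) => u v w; field.
Qed.

End ray.

Section step.
Variable nu : probability R R.
Hypothesis nusym : forall A : set R, measurable A -> nu (-%R @^-1` A) = nu A.
Local Notation G := (Gf alpha nu).
Local Notation H := (Hf alpha nu).

(** Every integrand below is affine in the [alpha]-th power of the absolute value of [y] on
    [[-a, a]] and zero outside, hence a combination of [ind] and [mom]. Thus only the mass [n0 a]
    and the [alpha]-moment [n1 a] of [nu] on [[-a, a]] enter. *)
Let ind (a y : R) : R := if `|y| <= a then 1 else 0.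
Let mom (a y : R) : R := if `|y| <= a then `|y| `^ alpha else 0.
Let n0 a := (\int[nu]_y ind a y)%R.
Let n1 a := (\int[nu]_y mom a y)%R.

Let nuoo : (nu setT < +oo)%E.
Proof. by rewrite probability_setT ltry. Qed.

Let mle a : measurable_fun [set: R] (fun y : R => `|y| <= a).
Proof. by apply: measurable_fun_ler => //; exact: normr_measurable. Qed.

Let ind_integrable a k : nu.-integrable setT (EFin \o (fun y => k * ind a y)).
Proof.
apply: (bounded_integrable _ _ _ _ _ _ `|k|) => //.
  by apply: measurable_funM => //; exact: measurable_fun_ifT.
by move=> y; rewrite /ind; case: ifP => _; rewrite ?mulr1// mulr0 normr0.
Qed.

Let mom_integrable a k : nu.-integrable setT (EFin \o (fun y => k * mom a y)).
Proof.
apply: (bounded_integrable _ _ _ _ _ _ (`|k| * a `^ alpha)) => //.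
  apply: measurable_funM => //; apply: measurable_fun_ifT => //.
  by apply: (measurableT_comp (measurable_powR _)); exact: normr_measurable.
move=> y; rewrite normrM ler_wpM2l// /mom; case: ifP => ya; last first.
  by rewrite normr0 powR_ge0.
rewrite ger0_norm ?powR_ge0//; apply: ge0_ler_powR => //; first exact: ltW.
by rewrite nnegrE (le_trans _ ya).
Qed.

Let int_comb a p q :
  (\int[nu]_y (p * ind a y + q * mom a y))%R = p * n0 a + q * n1 a.
Proof.
have i1 : nu.-integrable setT (EFin \o ind a).
  by have := ind_integrable a 1; rewrite /comp; under eq_fun do rewrite mul1r.
have m1 : nu.-integrable setT (EFin \o mom a).
  by have := mom_integrable a 1; rewrite /comp; under eq_fun do rewrite mul1r.
by rewrite RintegralD// !RintegralZl.
Qed.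

Let cut_comb a t y : 0 < a -> a <= t ->
  cut a t y = 1 * ind a y + (- (t `^ alpha)^-1) * mom a y.
Proof.
move=> a0 aT; rewrite /cut_Psi /ind /mom; case: ifP => ya; last by rewrite !mulr0 addr0.
rewrite Psi_div// ?(lt_le_trans a0)// ?(le_trans ya)//.
by rewrite mulr1 mulNr mulrC.
Qed.

Let cut_int_comb a t : 0 < a -> a <= t ->
  cut_int nu a t = n0 a - n1 a / t `^ alpha.
Proof.
move=> a0 aT; rewrite -[LHS]/(\int[nu]_y cut a t y)%R.
under eq_Rintegral do rewrite cut_comb//.
by rewrite int_comb mul1r mulNr mulrC.
Qed.

Lemma cut_int_Gf (a : R) : 0 < a -> cut_int nu a a = G a.
Proof.
by move=> a0; congr fine; apply: eq_integral => y _; rewrite cut_Psi_id.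
Qed.

(** For the constant 1, [ge0_integral_even_ray] reads [2 F(a) = 1 + nu([-a, a])], and [2 F(a) - 1]
    is [H a + G a] by definition of [H]. *)
Let n0E a : 0 < a -> n0 a = H a + G a.
Proof.
move=> a0.
have := ge0_integral_even_ray nu nusym a (cst 1%E) (ltW a0).
have mc : measurable_fun [set: R] (cst (1%E : \bar R)) by [].
have mray : measurable [set x : R | x <= a] by rewrite -set_itvNyc.
move=> /(_ mc (fun=> lee01) (fun=> erefl)).
rewrite !integral_cst// !mul1e => /(congr1 fine).
rewrite !fineD ?probability_setT ?fin_num_measure//=.
rewrite -/(Fdf nu a) /Hf => E.
have E1 : fine (nu setT) = 1 by rewrite probability_setT.
have -> : n0 a = fine (nu `[(- a)%R, a]%classic).
  rewrite /n0 /Rintegral -[X in nu X]setIT -integral_indic//.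
  congr fine; apply: eq_integral => y _; congr EFin.
  rewrite /ind indicE; case: ifPn => [|/negP] ya.
    by rewrite mem_set//= in_itv/= -ler_norml.
  by rewrite memNset//= in_itv/= -ler_norml.
by move: E; rewrite E1; move: (fine (nu _)) (Fdf nu a) (Gf alpha nu a) => u v w; lra.
Qed.

(** Taking [t = a] in [cut_int_comb] expresses [G a] through [n0 a] and [n1 a]; with [n0E] this is
    solved for [n1 a]. *)
Let n1E a : 0 < a -> n1 a = H a * a `^ alpha.
Proof.
move=> a0; have := cut_int_comb a a a0 (lexx a).
rewrite cut_int_Gf// n0E//; move: (G a) (H a) (n1 a) => g h n E.
have A0 : a `^ alpha != 0 by rewrite gt_eqF ?powR_gt0.
apply: (mulIf (invr_neq0 A0)); rewrite mulfK//; lra.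
Qed.

Lemma cut_int_nu (a t : R) : 0 < a -> a <= t ->
  cut_int nu a t = G a + H a * Psi (a / t).
Proof.
move=> a0 aT; have t0 : 0 < t by exact: lt_le_trans aT.
rewrite cut_int_comb// n0E// n1E// Psi_div// (gtr0_norm a0)//.
by move: (G a) (H a) => g h; field; rewrite !gt_eqF ?powR_gt0.
Qed.

(** For [|x| > a] both sides vanish. Otherwise the inner integral is affine in the [alpha]-th power
    of [|y|] for [|y| <= a], and integrating it in [y] uses only [n0 a] and [n1 a]. *)
Lemma cut_int_kend_step (a t x : R) : 0 < a -> a <= t ->
  cut_int (kend_step alpha alpha_gt0 nu x) a t =
  G a * cut a t x + H a * Psi (a / t) * cut a a x.
Proof.
move=> a0 aT; have t0 : 0 < t by exact: lt_le_trans aT.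
have A0 : a `^ alpha != 0 by rewrite gt_eqF ?powR_gt0.
have T0 : t `^ alpha != 0 by rewrite gt_eqF ?powR_gt0.
have mc : measurable_fun [set: R] (EFin \o cut a t).
  by apply/measurable_EFinP; exact: measurable_cut_Psi.
have c0 z : (0 <= (EFin \o cut a t) z)%E by rewrite lee_fin cut_Psi_ge0.
rewrite /cut_int (ge0_integral_kend_step _ _ _ _ _ mc c0) /=.
under eq_integral do rewrite (integral_kend_ker_cut_Psi _ _ a t)//.
rewrite /cut_Psi; have [xa|xa] := leP `|x| a; last first.
  rewrite !mulr0 addr0 (_ : (fun y : R => _) = cst 0%E) ?integral0//.
rewrite /=; set X := `|x| `^ alpha; set A := a `^ alpha; set T := t `^ alpha.
transitivity (\int[nu]_y ((1 - X / T) * ind a y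
    + (X * (2 / (T * A) - A ^- 2) - T^-1) * mom a y))%R.
  congr fine; apply: eq_integral => y _; congr EFin.
  rewrite /ind /mom; case: ifP => _; last by rewrite !mulr0 addr0.
  by ring.
rewrite int_comb n0E// n1E// !Psi_div// ?(le_trans xa)// ?(gtr0_norm a0)//.
rewrite -/X -/A -/T in A0 T0 *; move: (G a) (H a) => g h.
by field; rewrite A0.
Qed.

End step.
End cut_integrals.

(** * The killed walk *)

Section recursion.
Context {R : realType} (alpha : R).
Hypothesis alpha_gt0 : 0 < alpha.
Variable nu : probability R R.
Hypothesis nusym : forall A : set R, measurable A -> nu (-%R @^-1` A) = nu A.
Variables a t : R.
Hypotheses (a_gt0 : 0 < a) (a_le_t : a <= t).
Local Notation Psi := (Psi alpha).
Local Notation cut := (cut_Psi alpha).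
Local Notation Ga := (Gf alpha nu a).
Local Notation Gt := (Gf alpha nu t).
Local Notation h := (Hf alpha nu a * Psi (a / t)).
Local Notation D := (2 * Ga - Gt).
Hypothesis D_neq0 : D != 0.

Let t_gt0 : 0 < t. Proof. exact: lt_le_trans a_le_t. Qed.

(** This removes the [H] term of [cut_int_kend_step] when both parameters agree, so that over the
    whole line f1 and f3 are mapped to multiples of themselves. *)
Let Psi1 (b : R) : 0 < b -> Psi (b / b) = 0.
Proof. by move=> b0; rewrite divff ?gt_eqF// Psi_ge1E// normr1. Qed.

Lemma ray_kend_kernel_comb (c d e x : R) :
  fine (\int[kend_kernel alpha nu x]_(y in [set y : R | (y <= a)%R])
     (c * cut t t y + d * cut a t y + e * cut a a y)%:E)%E =
  (c * (Gt / 2)) * cut t t x + (c * (Ga / 2) + d * Ga) * cut a t x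
  + (c * (h / 2) + d * h + e * Ga) * cut a a x.
Proof.
rewrite (integral_kend_kernel alpha alpha_gt0).
have soo : (kend_step alpha alpha_gt0 nu x setT < +oo)%E.
  by rewrite kend_step_setT ltry.
rewrite (ray_cut_Psi_comb alpha _ soo (kend_step_sym alpha alpha_gt0 nu x))//.
rewrite !cut_int_kend_step// !Psi1//.
move: (cut t t x) (cut a t x) (cut a a x) (Hf _ _ t) Ga Gt (Hf _ _ a) (Psi _).
by move=> *; field.
Qed.

(* Coordinates on f1, f2, f3 of the k-th iterate of the killed step applied to f1. *)
Definition coef_t k : R := (Gt / 2) ^+ k.
Definition coef_at k : R := Ga / D * (Ga ^+ k - (Gt / 2) ^+ k).
Definition coef_a k : R :=
  h * Gt / D ^+ 2 * ((Gt / 2) ^+ k - Ga ^+ k) + h / D * k%:R * Ga ^+ k.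

(** The coefficients solve the triangular recurrence of [ray_kend_kernel_comb] from [(1, 0, 0)]. Its
    diagonal is [Gt / 2], [Ga], [Ga]: the repeated entry produces the term in [k * Ga^k], and the
    gap [Ga - Gt / 2 = D / 2] produces the denominators. *)
Lemma Iinner_cut_Psi k x :
  Iinner alpha nu a t k x =
  coef_t k * cut t t x + coef_at k * cut a t x + coef_a k * cut a a x.
Proof.
elim: k x => [|k IHk] x.
  rewrite /= /coef_t /coef_at /coef_a !expr0 subrr !mulr0 !mul0r !addr0 mul1r.
  by rewrite !mul0r !addr0 cut_Psi_id.
rewrite /= (funext IHk : Iinner alpha nu a t k = _).
rewrite ray_kend_kernel_comb /coef_t /coef_at /coef_a !exprS -natr1.
move: D_neq0; move: (cut t t x) (cut a t x) (cut a a x) Ga Gt (Hf _ _ a) (Psi _).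
by move=> u v w g1 g2 h1 p D0; move: (_ ^+ k) (g1 ^+ k) => E1 E2; field.
Qed.

(** The first of the [n] integrations is against [nu], leaving [n.-1] killed steps. Over the ray,
    f1, f2 and f3 integrate to [(Gt + Ga + h) / 2], [Ga + h] and [Ga]. *)
Lemma Ifun_closed n :
  Ifun alpha nu n a t =
  coef_t n.-1 * ((Gt + (Ga + h)) / 2) + coef_at n.-1 * (Ga + h) + coef_a n.-1 * Ga.
Proof.
rewrite /Ifun; under eq_integral do rewrite Iinner_cut_Psi.
have nuoo : (nu setT < +oo)%E by rewrite probability_setT ltry.
rewrite (ray_cut_Psi_comb alpha _ nuoo nusym)//.
rewrite (cut_int_Gf alpha alpha_gt0 nu t t_gt0) (cut_int_Gf alpha alpha_gt0 nu a a_gt0).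
by rewrite (cut_int_nu alpha alpha_gt0 nu nusym a t a_gt0 a_le_t).
Qed.

End recursion.

Theorem mainTheorem7 (R : realType) (alpha : R) (nu : probability R R) (a t : R) :
  0 < alpha ->
  (forall A : set R, measurable A -> nu [set - x | x in A] = nu A) ->
  nu [set 0] = 0%E ->
  0 < a -> a <= t ->
  nu [set a] = 0%E -> nu [set t] = 0%E ->
  Gf alpha nu t != 2 * Gf alpha nu a ->
  let G := Gf alpha nu in
  let H := Hf alpha nu in
  let I := fun n => Ifun alpha nu n a t in
  let D := 2 * G a - G t in
  let C1 := I 1%N - G a / D * (G a + H a * Psi alpha (a / t) * (1 - G t / D)) in
  let C2 := H a * Psi alpha (a / t) / D in
  let C3 := (H a * Psi alpha (a / t) + G a) / D
            - 2 * H a * G a * Psi alpha (a / t) / D ^+ 2 in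
  I 1%N = G t / 2 + H a * Psi alpha (a / t) / 2 + G a / 2 /\
  (forall n : nat, (2 <= n)%N ->
     I n = C1 * (G t / 2) ^+ n.-1 + G a ^+ n * (C2 * n%:R + C3)).
Proof.
move=> alpha0 nusym _ a0 aT _ _ GD G H I D C1 C2 C3.
have nusym' (A : set R) : measurable A -> nu (-%R @^-1` A) = nu A.
  move=> mA; rewrite -(nusym A mA); congr (nu _); apply/seteqP; split => x /=.
    by move=> Ax; exists (- x); rewrite ?opprK.
  by move=> [y Ay <-]; rewrite opprK.
have D0 : D != 0 by rewrite subr_eq0 eq_sym.
have IE n := Ifun_closed alpha alpha0 nu nusym' a t a0 aT D0 n.
have I1 : I 1%N = G t / 2 + H a * Psi alpha (a / t) / 2 + G a / 2.
  rewrite /I IE /coef_t /coef_at /coef_a /= !expr0 subrr mul1r !mulr0 !mul0r !addr0.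
  rewrite -/(G t) -/(G a) -/(H a).
  by move: (G t) (G a) (H a) (Psi _ _) => *; field.
(* With [n = k + 1], both sides become linear in the [k]-th powers of [G t / 2] and [G a], and the
   identity holds with these powers treated as independent unknowns. *)
split => // -[//|k] _; rewrite /C1 I1 /C2 /C3 /I IE /coef_t /coef_at /coef_a /=.
rewrite [G a ^+ k.+1]exprS -[k.+1%:R]natr1 -/(G t) -/(G a) -/(H a).
move: D0; rewrite /D; move: (G t) (G a) (H a) (Psi _ _) => g2 g1 h p.
by move: (_ ^+ k) (g1 ^+ k) => E1 E2 D0; field.
Qed.
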